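(* Let $\nu_0\in\mathcal P_2(\mathbb R^d)$, and let $(\mathcal T_t)_{t\in[0,t_f]}\in AC([0,t_f],L^2_{\nu_0})$ be a curve of diffeomorphisms of $\mathbb R^d$ solving the projected dynamics $$\dot{\mathcal T}_t=\begin{cases}\mathrm P_{V_t}\big(v_{\nu_t}\circ\mathcal T_t\big), & \text{if }\boldsymbol c_t=0,\\ \mathrm P_{\mathbb W_m}\big(v_{\nu_t}\circ\mathcal T_t\big), & \text{if }\boldsymbol c_t\neq0,\end{cases}\qquad v_{\nu_t}=-\partial^\circ\mathcal F(\nu_t),$$ such that $\nu_t=\mathcal T_t\#\nu_0$. Then $(\nu_t)_{t\in[0,t_f]}\in AC([0,t_f],\mathcal P_2(\mathbb R^d))$, i.e. it is an absolutely continuous curve in $\mathcal P_2(\mathbb R^d)$ for the Wasserstein distance $W_2$.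
   Context: $\mathcal P_2(\mathbb R^d)$ is the set of Borel probability measures with finite second moment, with the $2$-Wasserstein distance $W_2$. For $\mu\in\mathcal P_2(\mathbb R^d)$, $L^2_\mu=L^2((\mathbb R^d,\mu),\mathbb R^d)$. $t_f>0$ is a fixed final time. Energy: $\mathcal F(\mu)=\int_{\mathbb R^d}F(x,\rho,\nabla\rho)\,dx$ if $\mu=\rho\,\mathcal L^d$ with $\rho\in C^1(\mathbb R^d)$, and $+\infty$ otherwise, where $F:\mathbb R^d\times\mathbb R_+\times\mathbb R^d\to\mathbb R_+$ is at least $C^2$ with $F(x,0,p)=0$. $\partial^\circ\mathcal F(\mu)\in L^2_\mu$ denotes the minimal-norm element of the Wasserstein (Fréchet) subdifferential of $\mathcal F$ at $\mu$; for this class it equals $\nabla\big(\frac{\delta\mathcal F}{\delta\mu}(\mu)\big)$ with $\frac{\delta\mathcal F}{\delta\mu}(\mu)=F_z(x,\rho,\nabla\rho)-\nabla\cdot F_p(x,\rho,\nabla\rho)$. Thus $v_{\nu_t}\in L^2_{\nu_t}$ and $v_{\nu_t}\circ\mathcal T_t\in L^2_{\nu_0}$. Stiefel representation: $\mathbb W_m\subset L^2_{\nu_0}$ is a linear subspace of finite dimension $m\ge n$; the approximate map is $\mathcal T_t=\sum_{i=1}^n c_{t,i}v_{t,i}$, with $\boldsymbol c_t\in\mathbb R^n$ and $\boldsymbol v_t=\{v_{t,1},\dots,v_{t,n}\}\subset\mathbb W_m$ an $L^2_{\nu_0}$-orthonormal frame; $V_t=\mathrm{span}\{\boldsymbol v_t\}$.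 $\mathrm P_S$ is the $L^2_{\nu_0}$-orthogonal projection onto a closed subspace $S$. The equation is understood for a.e. $t\in[0,t_f]$. *)

(* Defs.v *)
From HB Require Import structures.
From mathcomp Require Import all_boot all_order all_algebra.
From mathcomp Require Import all_classical all_reals all_analysis.

Set Implicit Arguments.
Unset Strict Implicit.
Unset Printing Implicit Defensive.

Import Order.TTheory GRing.Theory Num.Theory.
Import numFieldNormedType.Exports.

Local Open Scope classical_set_scope.
Local Open Scope ring_scope.

(* R^d is 'rV[R]_d, with its Borel sigma-algebra. *)
HB.instance Definition _ (R : realType) (d : nat) :=
  @isMeasurable.Build (sigma_display (@open 'rV[R]_d)) 'rV[R]_d
    <<s @open 'rV[R]_d >> (@sigma_algebra0 _ setT _) (@sigma_algebraC _ _)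
    (@sigma_algebra_bigcup _ setT _).

Section BorelRowVectors.
Variable R : realType.

Lemma measurable_rVE d :
  @measurable _ 'rV[R]_d = <<s @open 'rV[R]_d >>.
Proof. by []. Qed.

Lemma open_measurable_rV d (U : set 'rV[R]_d) : open U -> measurable U.
Proof. by move=> oU; exact: sub_sigma_algebra. Qed.

Lemma continuous_measurable_rV d d' (f : 'rV[R]_d -> 'rV[R]_d') :
  continuous f -> measurable_fun setT f.
Proof.
move=> cf; apply: (measurability _ (measurable_rVE _)).
move=> _ [U oU <-].
by rewrite setTI; apply: open_measurable_rV; exact: open_comp.
Qed.

Lemma measurable_coord_rV d (i : 'I_d) :
  measurable_fun setT (fun x : 'rV[R]_d => x ord0 i).
Proof.
apply: (measurability _ (measurable_realfun.RGenOpens.measurableE R)) => _ [_ [a [b ->]] <-].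
rewrite setTI; apply: open_measurable_rV.
apply: open_comp => [x _|]; first exact: coord_continuous.
exact: interval_open.
Qed.

Lemma measurable_rVP dd (T : measurableType dd) d (f : T -> 'rV[R]_d) :
  (forall i, measurable_fun setT (fun t => f t ord0 i)) -> measurable_fun setT f.
Proof.
move=> mf; apply: (measurability _ (measurable_rVE _)).
move=> _ [U oU <-]; rewrite setTI.
pose P (q : 'rV[rat]_d * rat) : Prop :=
  0 < q.2 /\ forall y : 'rV[R]_d,
    (forall i, `|y ord0 i - ratr (q.1 ord0 i)| < ratr q.2) -> U y.
pose A (q : 'rV[rat]_d * rat) : set T :=
  [set t | P q /\ forall i, `|f t ord0 i - ratr (q.1 ord0 i)| < ratr q.2].
have -> : f @^-1` U = \bigcup_q A q.
  apply/seteqP; split=> t /=; last by move=> [q _ [[_ Pq]]] Aq; exact: Pq.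
  move=> Uft; have /nbhs_ballP[e /= e0 eU] : nbhs (f t) U by exact: open_nbhs_nbhs.
  have [r] := rat_in_itvoo (divr_gt0 e0 (ltr0Sn R 1)).
  rewrite in_itv/= => /andP[r0 re].
  have rr i : f t ord0 i - ratr r < f t ord0 i + ratr r by rewrite ltrD2l gtrN.
  pose q := \row_i sval (cid (rat_in_itvoo (rr i))).
  have qP i : `|f t ord0 i - ratr (q ord0 i)| < ratr r.
    rewrite /q mxE; case: cid => /= s; rewrite in_itv/= => /andP[s1 s2].
    by rewrite distrC ltr_distl s1 s2.
  exists (q, r) => //; split=> //=; split=> /=; first by rewrite -(@ltr0q R).
  move=> y yq; apply: eU; split=> // i j; rewrite ord1 /ball /=.
  rewrite -(subrKA (ratr (q ord0 j))) (le_lt_trans (ler_normD _ _))//.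
  rewrite (splitr e) (lt_trans _ (ltrD re re))//.
  by rewrite ltrD// distrC.
apply: countable_bigcupT_measurable => [|q].
  exact: countableP.
have [Pq|Pq] := pselect (P q); last first.
  by rewrite (_ : A q = set0)//; apply/seteqP; split=> // t [].
have -> : A q = \bigcap_(i in [set: 'I_d])
    (setT `&` (fun t => f t ord0 i - ratr (q.1 ord0 i)) @^-1`
       `](- ratr q.2), (ratr q.2)[%classic).
  apply/seteqP; split=> t /=.
    by move=> [_ Aq] i _; split=> //=; rewrite in_itv/= -ltr_norml.
  move=> Aq; split=> // i; have [_ /=] := Aq i I.
  by rewrite in_itv/= -ltr_norml.
apply: fin_bigcap_measurable => // i _.
by apply: measurable_realfun.measurable_funB => //; exact: measurable_itv.
Qed.

Definition cons_rV d (p : R * 'rV[R]_d) : 'rV[R]_(1 + d) :=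
  row_mx p.1%:M p.2.

Lemma measurable_cons_rV d : measurable_fun setT (@cons_rV d).
Proof.
apply: measurable_rVP => i; rewrite /cons_rV.
case: (split_ordP i) => j ->.
  rewrite (ord1 j); under eq_fun do rewrite row_mxEl mxE mulr1n.
  exact: measurable_fst.
under eq_fun do rewrite row_mxEr.
exact: (measurableT_comp (measurable_coord_rV j) measurable_snd).
Qed.

Definition uncons_rV d (x : 'rV[R]_(1 + d)) : R * 'rV[R]_d :=
  (x ord0 (lshift d ord0), rsubmx x).

Lemma measurable_uncons_rV d : measurable_fun setT (@uncons_rV d).
Proof.
apply/measurable_fun_pairP; split; first exact: measurable_coord_rV.
apply: measurable_rVP => i /=.
under eq_fun do rewrite mxE.
exact: measurable_coord_rV.
Qed.

Lemma cons_rVK d : cancel (@cons_rV d) (@uncons_rV d).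
Proof.
by move=> [a x]; rewrite /uncons_rV /cons_rV /= row_mxEl mxE mulr1n row_mxKr.
Qed.

Section LebesgueStep.
Local Open Scope ereal_scope.
Variables (d : nat) (m : {sigma_finite_measure set 'rV[R]_d -> \bar R}).

Definition lebesgue_cons : set 'rV[R]_(1 + d) -> \bar R :=
  pushforward (@lebesgue_measure R \x m) (@cons_rV d).

Let lebesgue_cons0 : lebesgue_cons set0 = 0.
Proof. by rewrite /lebesgue_cons /pushforward preimage_set0 measure0. Qed.

Let lebesgue_cons_ge0 A : 0 <= lebesgue_cons A.
Proof. exact: (measure_ge0 (@lebesgue_measure R \x m)). Qed.

Let lebesgue_cons_sigma_additive : semi_sigma_additive lebesgue_cons.
Proof.
have mc A : measurable A -> measurable (@cons_rV d @^-1` A).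
  by move=> mA; rewrite -[X in measurable X]setTI; exact: measurable_cons_rV.
move=> F mF tF mUF; rewrite /lebesgue_cons /pushforward preimage_bigcup.
apply: measure_semi_sigma_additive.
- by move=> n; exact: mc.
- apply/trivIsetP => i j _ _ ij; rewrite -preimage_setI.
  by move/trivIsetP : tF => /(_ _ _ _ _ ij) ->//; rewrite preimage_set0.
- by rewrite -preimage_bigcup; exact: mc.
Qed.

HB.instance Definition _ := isMeasure.Build _ _ _ lebesgue_cons
  lebesgue_cons0 lebesgue_cons_ge0 lebesgue_cons_sigma_additive.

Let lebesgue_cons_sigma_finite : sigma_finite setT lebesgue_cons.
Proof.
have /sigma_finiteP[F [TF ndF Foo]] := sigma_finiteT (@lebesgue_measure R).
have /sigma_finiteP[G [TG ndG Goo]] := sigma_finiteT m.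
exists (fun n => @uncons_rV d @^-1` (F n `*` G n)).
  rewrite -preimage_bigcup (_ : \bigcup_n _ = setT) ?preimage_setT//.
  rewrite -setXTT TF TG predeqE => -[x y]; split.
    by move=> [n _ []/= ? ?]; split; exists n.
  move=> [/= [n _ Fnx] [k _ Gky]]; exists (maxn n k) => //; split.
  - by move: x Fnx; exact/subsetPset/ndF/leq_maxl.
  - by move: y Gky; exact/subsetPset/ndG/leq_maxr.
move=> k; have [? ?] := Foo k; have [? ?] := Goo k; split.
  rewrite -[X in measurable X]setTI; apply: measurable_uncons_rV => //.
  exact: measurableX.
rewrite /lebesgue_cons /pushforward -comp_preimage.
rewrite (_ : _ \o _ = id); last by apply/funext => x; exact: cons_rVK.
by rewrite preimage_id product_measure1E// lte_mul_pinfty// ge0_fin_numE.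
Qed.

HB.instance Definition _ := Measure_isSigmaFinite.Build _ _ _ lebesgue_cons
  lebesgue_cons_sigma_finite.

End LebesgueStep.

(* The Lebesgue measure of R^d, as the d-fold product of the Lebesgue measure
   of the line (the Dirac mass at the only point when d = 0). *)
Fixpoint lebesgue_rV d : {sigma_finite_measure set 'rV[R]_d -> \bar R} :=
  match d with
  | 0 => dirac (0 : 'rV[R]_0)
  | d'.+1 => lebesgue_cons (lebesgue_rV d')
  end.

End BorelRowVectors.

Section Calculus.
Variable R : realType.

(* In finite dimension, the derivative is a C^k map into the linear maps
   if and only if all its evaluations at fixed vectors are C^k. *)
Fixpoint of_class_C (V W : normedModType R) (k : nat) (f : V -> W) : Prop :=
  match k with
  | 0 => continuous f
  | k'.+1 => (forall x, differentiable f x) /\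
             (forall v, of_class_C k' (fun x => 'd f x v))
  end.

Definition C1_diffeomorphism d (T : 'rV[R]_d -> 'rV[R]_d) : Prop :=
  exists S, [/\ cancel T S, cancel S T, of_class_C 1 T & of_class_C 1 S].

Definition gradient d (f : 'rV[R]_d -> R) (x : 'rV[R]_d) : 'rV[R]_d :=
  \row_i 'D_(delta_mx ord0 i) f x.

(* F(x, z, p) is only meaningful for 0 <= z; C^2 up to the boundary z = 0 means
   that F has a C^2 extension to the whole space. *)
Definition integrand d (F : 'rV[R]_d -> R -> 'rV[R]_d -> R) : Prop :=
  [/\ forall x z p, 0 <= z -> 0 <= F x z p,
      forall x p, F x 0 p = 0
    & exists2 G : 'rV[R]_d * R * 'rV[R]_d -> R,
        of_class_C 2 G & forall x z p, 0 <= z -> G (x, z, p) = F x z p].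

End Calculus.

Section AbsolutelyContinuousCurves.
Variables (R : realType) (X : Type).
Local Open Scope ereal_scope.

(* u is in AC([a, b], X) for the distance dist. *)
Definition AC_curve (dist : X -> X -> \bar R) (a b : R) (u : R -> X) : Prop :=
  exists2 g : R -> R,
    (@lebesgue_measure R).-integrable `[a, b] (EFin \o g) &
    forall s t, (a <= s)%R -> (s <= t)%R -> (t <= b)%R ->
      dist (u s) (u t) <= \int[@lebesgue_measure R]_(r in `[s, t]) (g r)%:E.

End AbsolutelyContinuousCurves.

Section Wasserstein.
Variables (R : realType) (d : nat).
Local Notation Rd := 'rV[R]_d.
Local Open Scope ereal_scope.

Definition dotp (x y : Rd) : R := (\sum_(i < d) x ord0 i * y ord0 i)%R.

Implicit Types (mu nu : probability Rd R) (gamma : probability (Rd * Rd)%type R).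

Definition P2 mu : Prop := \int[mu]_x (dotp x x)%:E < +oo.

(* Elements of L^2((R^d, mu), R^d) are represented by maps,
   up to mu-a.e. equality. *)
Definition L2 mu (f : Rd -> Rd) : Prop :=
  measurable_fun setT f /\ \int[mu]_x (dotp (f x) (f x))%:E < +oo.

Definition L2inner mu (f g : Rd -> Rd) : \bar R :=
  \int[mu]_x (dotp (f x) (g x))%:E.

Definition L2norm mu (f : Rd -> Rd) : \bar R := sqrte (L2inner mu f f).

Definition L2dist mu (f g : Rd -> Rd) : \bar R := L2norm mu (f \- g)%R.

Definition coupling mu nu gamma : Prop :=
  forall A, measurable A ->
    gamma (fst @^-1` A) = mu A /\ gamma (snd @^-1` A) = nu A.

Definition transport_cost gamma : \bar R :=
  \int[gamma]_z (dotp (z.1 - z.2) (z.1 - z.2))%:E.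

Definition W2 mu nu : \bar R :=
  sqrte (ereal_inf [set transport_cost gamma | gamma in coupling mu nu]).

Definition optimal_plan mu nu gamma : Prop :=
  coupling mu nu gamma /\
  forall gamma', coupling mu nu gamma' ->
    transport_cost gamma <= transport_cost gamma'.

Definition C1_density mu (rho : Rd -> R) : Prop :=
  [/\ forall x, (0 <= rho x)%R, of_class_C 1 rho
    & forall A, measurable A ->
        mu A = \int[lebesgue_rV R d]_(x in A) (rho x)%:E].

(* A C^1 density is unique, so the choice made by cid is irrelevant. *)
Definition energy (F : Rd -> R -> Rd -> R) mu : \bar R :=
  match pselect (exists rho, C1_density mu rho) with
  | left ex => let rho := sval (cid ex) in
      \int[lebesgue_rV R d]_x (F x (rho x) (gradient rho x))%:E
  | right _ => +oo
  end.

(* Wasserstein Frechet subdifferential: as nu tends to mu in (P_2, W_2),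
   E(nu) - E(mu) >= inf_gamma \int <xi(x), y - x> dgamma(x, y) + o(W_2(mu, nu)),
   where gamma ranges over the optimal plans from mu to nu. *)
Definition subdifferential (E : probability Rd R -> \bar R) mu (xi : Rd -> Rd)
    : Prop :=
  [/\ P2 mu, E mu < +oo, L2 mu xi &
    forall eps : R, (0 < eps)%R -> exists2 delta : R, (0 < delta)%R &
      forall nu, P2 nu -> W2 mu nu < delta%:E ->
        E mu
        + ereal_inf [set \int[gamma]_z (dotp (xi z.1) (z.2 - z.1))%:E
                    | gamma in optimal_plan mu nu]
        - eps%:E * W2 mu nu <= E nu].

Definition minimal_subgradient (E : probability Rd R -> \bar R) mu
    (xi : Rd -> Rd) : Prop :=
  subdifferential E mu xi /\
  forall eta, subdifferential E mu eta -> L2norm mu xi <= L2norm mu eta.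

End Wasserstein.

Section L2Subspaces.
Variables (R : realType) (d : nat) (mu : probability 'rV[R]_d R).
Local Notation map := ('rV[R]_d -> 'rV[R]_d).

Definition lincomb n (a : 'rV[R]_n) (e : 'I_n -> map) : map :=
  fun x => \sum_(i < n) a ord0 i *: e i x.

Definition L2span n (e : 'I_n -> map) : set map :=
  [set f | L2 mu f /\ exists a : 'rV[R]_n, f = lincomb a e %[ae mu]].

Definition L2subspace (m : nat) (W : set map) : Prop :=
  exists b : 'I_m -> map,
    [/\ forall i, L2 mu (b i),
        forall a : 'rV[R]_m, lincomb a b = cst 0 %[ae mu] -> a = 0
      & W = L2span b].

(* e is an L^2-orthonormal n-frame of W, i.e. a point of the Stiefel manifold. *)
Definition orthonormal_frame n (W : set map) (e : 'I_n -> map) : Prop :=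
  (forall i, W (e i)) /\
  forall i j, L2inner mu (e i) (e j) = (i == j)%:R%:E.

Definition orthogonal_projection (S : set map) (f p : map) : Prop :=
  S p /\ forall g, S g -> L2inner mu (f \- p) g = 0%E.

(* D is the derivative at t, in L^2, of the curve T. *)
Definition L2derivative (T : R -> map) (t : R) (D : map) : Prop :=
  L2 mu D /\
  L2norm mu (fun x => h^-1 *: (T (t + h) x - T t x) - D x)
    @[h --> (0 : R)^'] --> 0%E.

End L2Subspaces.

(* Main.v *)
Require Import Defs.
From mathcomp Require Import all_boot all_order all_algebra.
From mathcomp Require Import all_classical all_reals all_analysis.

(** The second moment of f # mu is the squared norm of f in L^2(mu), and the law
    of the pair (f, g) under mu is a coupling of f # mu and g # mu whose cost
    is the squared norm of f - g.  Hence f |-> f # mu maps L^2(mu)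
    to P_2 and is 1-Lipschitz from the L^2(mu) distance to W_2
    ([W2_le_L2dist]).  It therefore sends the absolutely continuous curve T
    of L^2(nu_0) to the absolutely continuous curve nu of P_2, with the same
    integrable bound on the metric speed. *)

Import Order.TTheory GRing.Theory Num.Theory.
Import numFieldNormedType.Exports.

Local Open Scope classical_set_scope.
Local Open Scope ring_scope.

Lemma dotp_ge0 (R : realType) d (x : 'rV[R]_d) : 0 <= dotp x x.
Proof. by apply: sumr_ge0 => i _; rewrite -expr2 sqr_ge0. Qed.

Lemma measurable_fun_dotp (R : realType) dd (X : measurableType dd) d
    (f g : X -> 'rV[R]_d) :
  measurable_fun setT f -> measurable_fun setT g ->
  measurable_fun setT (fun x => dotp (f x) (g x)).
Proof.
move=> mf mg; apply: measurable_sum => i.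
apply: measurable_realfun.measurable_funM.
- exact: (measurableT_comp (measurable_coord_rV i) mf).
- exact: (measurableT_comp (measurable_coord_rV i) mg).
Qed.

Lemma measurable_cost (R : realType) d :
  measurable_fun setT
    (fun z : 'rV[R]_d * 'rV[R]_d => dotp (z.1 - z.2) (z.1 - z.2)).
Proof.
have mB : measurable_fun setT (fun z : 'rV[R]_d * 'rV[R]_d => z.1 - z.2).
  apply: measurable_rVP => i; under eq_fun do rewrite !mxE.
  apply: measurable_realfun.measurable_funB.
  - exact: (measurableT_comp (measurable_coord_rV i) measurable_fst).
  - exact: (measurableT_comp (measurable_coord_rV i) measurable_snd).
exact: measurable_fun_dotp.
Qed.

Lemma P2_pushforward (R : realType) d (mu nu : probability 'rV[R]_d R)
    (f : 'rV[R]_d -> 'rV[R]_d) :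
  L2 mu f ->
  (forall A, measurable A -> nu A = pushforward mu f A) ->
  P2 nu.
Proof.
move=> [mf f2] nuE; pose X := mfun_Sub (mem_set mf).
have md : measurable_fun setT (fun x : 'rV[R]_d => dotp x x).
  by apply: measurable_fun_dotp; exact: measurable_id.
rewrite /P2 (eq_measure_integral (distribution mu X)); last first.
  by move=> A mA _; exact: nuE.
rewrite ge0_integral_distribution//; first exact/measurable_realfun.measurable_EFinP.
by move=> x; rewrite lee_fin dotp_ge0.
Qed.

(** The law of the pair (f, g) under mu is an admissible, in general not optimal,
    competitor in the infimum that defines W_2. *)
Lemma W2_le_L2dist (R : realType) d (mu nu1 nu2 : probability 'rV[R]_d R)
    (f g : 'rV[R]_d -> 'rV[R]_d) :
  measurable_fun setT f -> measurable_fun setT g ->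
  (forall A, measurable A -> nu1 A = pushforward mu f A) ->
  (forall A, measurable A -> nu2 A = pushforward mu g A) ->
  (W2 nu1 nu2 <= L2dist mu f g)%E.
Proof.
move=> mf mg nu1E nu2E.
have mfg : measurable_fun setT (fun x => (f x, g x)) by exact: measurable_fun_pair.
pose X := mfun_Sub (mem_set mfg).
rewrite /W2 /L2dist /L2norm lee_sqrt; last first.
  by apply: integral_ge0 => x _; rewrite lee_fin dotp_ge0.
apply: ge_ereal_inf; exists (transport_cost (distribution mu X)).
  exists (distribution mu X) => // A mA.
  by split; [rewrite nu1E | rewrite nu2E].
rewrite /transport_cost ge0_integral_distribution//.
- by apply/measurable_realfun.measurable_EFinP; exact: measurable_cost.
- by move=> z; rewrite lee_fin dotp_ge0.
Qed.

Theorem proposition4p1 (R : realType) (d n m : nat) (tf : R)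
    (F : 'rV[R]_d -> R -> 'rV[R]_d -> R)
    (nu : R -> probability 'rV[R]_d R)
    (T : R -> 'rV[R]_d -> 'rV[R]_d)
    (W : set ('rV[R]_d -> 'rV[R]_d))
    (c : R -> 'rV[R]_n)
    (e : R -> 'I_n -> 'rV[R]_d -> 'rV[R]_d)
    (vel : R -> 'rV[R]_d -> 'rV[R]_d) :
  0 < tf ->
  integrand F ->
  P2 (nu 0) ->
  (n <= m)%N ->
  L2subspace (nu 0) m W ->
  (forall t, t \in `[0, tf] ->
     orthonormal_frame (nu 0) W (e t) /\
     T t = lincomb (c t) (e t) %[ae nu 0]) ->
  (forall t, t \in `[0, tf] -> C1_diffeomorphism (T t)) ->
  (forall t, t \in `[0, tf] -> L2 (nu 0) (T t)) ->
  AC_curve (L2dist (nu 0)) 0 tf T ->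
  (forall t, t \in `[0, tf] ->
     forall A, measurable A -> nu t A = pushforward (nu 0) (T t) A) ->
  {ae @lebesgue_measure R, forall t, t \in `[0, tf] ->
     minimal_subgradient (energy F) (nu t) (\- vel t) /\
     exists2 Tdot, L2derivative (nu 0) T t Tdot &
       orthogonal_projection (nu 0)
         (if c t == 0 then L2span (nu 0) (e t) else W)
         (vel t \o T t) Tdot} ->
  (forall t, t \in `[0, tf] -> P2 (nu t)) /\
  AC_curve (@W2 R d) 0 tf nu.
Proof.
move=> _ _ _ _ _ _ _ TL2 [g ig Tg] nuE _; split.
  by move=> t t0f; apply: P2_pushforward (TL2 t t0f) (nuE t t0f).
exists g => // s t s0 st tf1.
have sI : s \in `[0, tf] by rewrite in_itv/= s0 (le_trans st).
have tI : t \in `[0, tf] by rewrite in_itv/= tf1 (le_trans s0).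
apply: le_trans (Tg s t s0 st tf1).
have [mTs _] := TL2 s sI; have [mTt _] := TL2 t tI.
exact: W2_le_L2dist mTs mTt (nuE s sI) (nuE t tI).
Qed.
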